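(* Let $q$ be a prime power, $2\le n\le m$ integers, $\mathcal{C}\le\mathbb{F}_q^{n\times m}$ an $\mathbb{F}_q$-linear subspace of dimension $k$, and $0\le i\le k$. For all $0\le u\le n$ and all $0\le w\le n$, $$B_u^{(i)}(\mathcal{C})=\sum_{w=0}^u \begin{bmatrix} n-w \\ u-w \end{bmatrix}_q A_w^{(i)}(\mathcal{C}),$$ $$A_w^{(i)}(\mathcal{C})=\sum_{u=0}^w\begin{bmatrix} n-u \\ w-u \end{bmatrix}_q(-1)^{w-u}q^{\binom{w-u}{2}}B_u^{(i)}(\mathcal{C}).$$
   Context: For $M\in\mathbb{F}_q^{n\times m}$, $\operatorname{colsp}(M)\le\mathbb{F}_q^n$ and $\operatorname{rowsp}(M)\le\mathbb{F}_q^m$ are the column space and row space. For a subspace $\mathcal{D}$ of matrices, $\operatorname{colsupp}(\mathcal{D})=\sum_{M\in\mathcal{D}}\operatorname{colsp}(M)$ and $\operatorname{rowsupp}(\mathcal{D})=\sum_{M\in\mathcal{D}}\operatorname{rowsp}(M)$. For a subspace $U$, $\mathcal{C}(U)=\{M\in\mathcal{C}:\operatorname{colsp}(M)\le U\}$ and $\mathcal{C}[U]=\{M\in\mathcal{C}:\operatorname{rowsp}(M)\le U\}$ (the latter used with $U\le\mathbb{F}_q^n$ only when $n=m$). $q$-binomial coefficient: for integers $a,b$, $\begin{bmatrix} a \\ b \end{bmatrix}_q$ is $0$ if $b<0$ or $0\le a<b$; $1$ if $b=0$; $\prod_{s=1}^b\frac{q^{a-s+1}-1}{q^s-1}$ if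 $b>0$ and $a\ge b$; and $(-1)^bq^{ab-\binom b2}\begin{bmatrix} -a+b-1 \\ b \end{bmatrix}_q$ if $b>0$ and $a<0$. Generalized binomial moments: for $0\le u\le n$, $$B_u^{(i)}(\mathcal{C})=\sum_{U\le\mathbb{F}_q^n,\ \dim U=u}\begin{bmatrix} \dim\mathcal{C}(U) \\ i \end{bmatrix}_q\ \text{ if } n<m,\qquad B_u^{(i)}(\mathcal{C})=\frac12\sum_{U\le\mathbb{F}_q^n,\ \dim U=u}\left(\begin{bmatrix} \dim\mathcal{C}(U) \\ i \end{bmatrix}_q+\begin{bmatrix} \dim\mathcal{C}[U] \\ i \end{bmatrix}_q\right)\ \text{ if } n=m.$$ Generalized rank weight distribution: for $W\le\mathbb{F}_q^n$ let $A_W^{(i)}(\mathcal{C},c)$ (respectively, for $n=m$, $A_W^{(i)}(\mathcal{C},r)$) be the number of $i$-dimensional subspaces $\mathcal{D}\le\mathcal{C}$ with $\operatorname{colsupp}(\mathcal{D})=W$ (respectively $\operatorname{rowsupp}(\mathcal{D})=W$). For $0\le w\le n$, $A_w^{(i)}(\mathcal{C})=\sum_{\dim W=w}A_W^{(i)}(\mathcal{C},c)$ if $n<m$, and $A_w^{(i)}(\mathcal{C})=\frac12\sum_{\dim W=w}\big(A_W^{(i)}(\mathcal{C},c)+A_W^{(i)}(\mathcal{C},r)\big)$ if $n=m$, sums over $W\le\mathbb{F}_q^n$. *)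

(* Defs.v *)
From HB Require Import structures.
From mathcomp Require Import all_boot all_order all_algebra.

Set Implicit Arguments.
Unset Strict Implicit.
Unset Printing Implicit Defensive.

Import Order.TTheory GRing.Theory Num.Theory.

Local Open Scope ring_scope.

(* A finite space has finitely many subspaces; MathComp has no such instance. *)
Section FiniteVspace.
Import VectorInternalTheory.
Variables (F : finFieldType) (vT : vectType F).
HB.instance Definition _ := [Finite of {vspace vT} by <:].
End FiniteVspace.

Definition qbinom (q : nat) (a b : int) : rat :=
  if b < 0 then 0
  else if b == 0 then 1
  else if a < 0 then
    let c := - a + b - 1 in (* c >= b > 0 *)
    (-1) ^ b * (q%:R : rat) ^ (a * b - 'C(`|b|, 2)%:Z) *
    \prod_(1 <= s < `|b|.+1)
      (((q%:R : rat) ^ (c - s%:Z + 1) - 1) / ((q%:R : rat) ^ s%:Z - 1))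
  else if a < b then 0
  else
    \prod_(1 <= s < `|b|.+1)
      (((q%:R : rat) ^ (a - s%:Z + 1) - 1) / ((q%:R : rat) ^ s%:Z - 1)).

Section Codes.
Variables (F : finFieldType) (n m : nat).

Definition colsp (M : 'M[F]_(n, m)) : {vspace 'cV[F]_n} :=
  <<[seq col j M | j <- enum 'I_m]>>%VS.

Definition rowsp (M : 'M[F]_(n, m)) : {vspace 'rV[F]_m} :=
  <<[seq row i M | i <- enum 'I_n]>>%VS.

Definition colsupp (D : {vspace 'M[F]_(n, m)}) : {vspace 'cV[F]_n} :=
  (\sum_(M : 'M[F]_(n, m) | M \in D) colsp M)%VS.

Definition rowsupp (D : {vspace 'M[F]_(n, m)}) : {vspace 'rV[F]_m} :=
  (\sum_(M : 'M[F]_(n, m) | M \in D) rowsp M)%VS.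

(* The spanning sets below are already subspaces: see memv_colcode and
   memv_rowcode. *)
Definition colcode (C : {vspace 'M[F]_(n, m)}) (U : {vspace 'cV[F]_n}) :
    {vspace 'M[F]_(n, m)} :=
  <<enum [set M : 'M[F]_(n, m) | (M \in C) && (colsp M <= U)%VS]>>%VS.

Definition rowcode (C : {vspace 'M[F]_(n, m)}) (U : {vspace 'rV[F]_m}) :
    {vspace 'M[F]_(n, m)} :=
  <<enum [set M : 'M[F]_(n, m) | (M \in C) && (rowsp M <= U)%VS]>>%VS.

Lemma colspP (M : 'M[F]_(n, m)) (U : {vspace 'cV[F]_n}) :
  reflect (forall j, col j M \in U) (colsp M <= U)%VS.
Proof.
apply: (iffP span_subvP) => [sMU j | sMU _ /mapP[j _ ->] //].
by apply: sMU; apply/mapP; exists j; rewrite ?mem_enum.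
Qed.

Lemma rowspP (M : 'M[F]_(n, m)) (U : {vspace 'rV[F]_m}) :
  reflect (forall i, row i M \in U) (rowsp M <= U)%VS.
Proof.
apply: (iffP span_subvP) => [sMU i | sMU _ /mapP[i _ ->] //].
by apply: sMU; apply/mapP; exists i; rewrite ?mem_enum.
Qed.

Lemma span_closed (P : pred 'M[F]_(n, m)) : P 0 ->
  (forall a A B, P A -> P B -> P (a *: A + B)) ->
  forall M, (M \in <<enum [set N | P N]>>%VS) = P M.
Proof.
move=> P0 PD M; apply/idP/idP => [|PM]; last first.
  by apply: memv_span; rewrite mem_enum inE.
have: {in enum [set N | P N], forall N, P N} by move=> N; rewrite mem_enum inE.
elim: (enum _) M => [|N s IHs] M Ps.
  by rewrite span_nil memv0 => /eqP->.
rewrite span_cons => /memv_addP[u /vlineP[a ->] [v vs ->]].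
apply: PD; first by apply: Ps; rewrite mem_head.
by apply: IHs => // x xs; apply: Ps; rewrite inE xs orbT.
Qed.

Lemma memv_colcode C U M :
  (M \in colcode C U) = (M \in C) && (colsp M <= U)%VS.
Proof.
rewrite /colcode (@span_closed (fun N => (N \in C) && (colsp N <= U)%VS)) //=.
  by rewrite mem0v; apply/colspP => j; rewrite linear0 mem0v.
move=> a A B /= /andP[AC /colspP AU] /andP[BC /colspP BU].
rewrite memvD ?memvZ //=.
by apply/colspP => j; rewrite linearP /= memvD ?memvZ ?AU ?BU.
Qed.

Lemma memv_rowcode C U M :
  (M \in rowcode C U) = (M \in C) && (rowsp M <= U)%VS.
Proof.
rewrite /rowcode (@span_closed (fun N => (N \in C) && (rowsp N <= U)%VS)) //=.
  by rewrite mem0v; apply/rowspP => j; rewrite linear0 mem0v.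
move=> a A B /= /andP[AC /rowspP AU] /andP[BC /rowspP BU].
rewrite memvD ?memvZ //=.
by apply/rowspP => j; rewrite linearP /= memvD ?memvZ ?AU ?BU.
Qed.

Implicit Type C : {vspace 'M[F]_(n, m)}.

(* Row spaces live in F^m, which is F^n in the only case n = m where they are
   used; the sum over subspaces of F^n is thus split into a column part over
   'cV_n and a row part over 'rV_m. *)
Definition gen_moment (i : nat) C (u : nat) : rat :=
  let colpart := \sum_(U : {vspace 'cV[F]_n} | \dim U == u)
    qbinom #|F| (\dim (colcode C U))%:Z i%:Z in
  let rowpart := \sum_(U : {vspace 'rV[F]_m} | \dim U == u)
    qbinom #|F| (\dim (rowcode C U))%:Z i%:Z in
  if (n < m)%N then colpart else 2^-1 * (colpart + rowpart).

Definition col_weight (i : nat) C (W : {vspace 'cV[F]_n}) : nat :=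
  #|[set D : {vspace 'M[F]_(n, m)} |
      [&& (D <= C)%VS, \dim D == i & colsupp D == W]]|.

Definition row_weight (i : nat) C (W : {vspace 'rV[F]_m}) : nat :=
  #|[set D : {vspace 'M[F]_(n, m)} |
      [&& (D <= C)%VS, \dim D == i & rowsupp D == W]]|.

Definition gen_weight (i : nat) C (w : nat) : rat :=
  let colpart := \sum_(W : {vspace 'cV[F]_n} | \dim W == w)
    (col_weight i C W)%:R in
  let rowpart := \sum_(W : {vspace 'rV[F]_m} | \dim W == w)
    (row_weight i C W)%:R in
  if (n < m)%N then colpart else 2^-1 * (colpart + rowpart).

End Codes.

(* Main.v *)
(* Grouping the i-dimensional subspaces D of C by their support, the moment B_u
   counts pairs (D, U) with supp D <= U and dim U = u; a support of dimension w
   lies in [n - w choose u - w]_q such U, which gives the first identity. The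
   second is q-binomial inversion: after the trinomial revision
   [n-u, w-u][n-v, u-v] = [n-v, w-v][w-v, u-v] it reduces to the vanishing of an
   alternating q-binomial sum. *)
Require Import Defs.
From mathcomp Require Import all_boot all_order all_algebra.
From mathcomp Require Import finfield ring zify.
Import Order.TTheory GRing.Theory Num.Theory.
Local Open Scope ring_scope.

(** * Identities for q-binomials with natural arguments *)

Section QBinomial.
Variable q : nat.

(** For [a < b] the factor at [s = a] is [q ^ 0 - 1 = 0], so one product covers both cases. *)
Lemma qbinomE (a b : nat) :
  qbinom q a b = \prod_(0 <= s < b) ((q%:R ^+ (a - s) - 1) / (q%:R ^+ s.+1 - 1)).
Proof.
rewrite /qbinom !ltz_nat /=; case: eqP => [[->]|_]; first by rewrite big_geq.
case: ltnP => [ab|ba].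
  rewrite (@big_cat_nat _ _ _ a) ?leq0n 1?ltnW //= (big_ltn ab) subnn expr0 subrr.
  by rewrite !mul0r mulr0.
rewrite big_add1 /=; apply: eq_big_nat => s /andP[_ sb].
by have -> : (a : int) - s.+1%:Z + 1 = (a - s)%N%:Z by lia.
Qed.

Lemma qbinom0 (a : nat) : qbinom q a 0 = 1.
Proof. by []. Qed.

Hypothesis q_gt1 : (1 < q)%N.

Lemma expq_sub1_neq0 b : (q%:R : rat) ^+ b.+1 - 1 != 0.
Proof. by rewrite subr_eq0 -natrX (eqr_nat _ _ 1) -(expn0 q) eqn_exp2l. Qed.

Lemma qbinomSS (a b : nat) :
  (q%:R ^+ b.+1 - 1) * qbinom q a.+1 b.+1 = (q%:R ^+ a.+1 - 1) * qbinom q a b.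
Proof.
rewrite !qbinomE !big_split /= big_nat_recl // big_nat_recr //= subn0.
by field; rewrite expq_sub1_neq0.
Qed.

Lemma qbinomnS (a b : nat) :
  (q%:R ^+ b.+1 - 1) * qbinom q a b.+1 = (q%:R ^+ (a - b) - 1) * qbinom q a b.
Proof.
rewrite !qbinomE big_nat_recr //=; field; exact: expq_sub1_neq0.
Qed.

Lemma qbinom_small (a b : nat) : (a < b)%N -> qbinom q a b = 0.
Proof. by move=> ab; rewrite /qbinom !ltz_nat ab; case: eqP => [[]|] //; lia. Qed.

(** Multiplied by [q ^ (b + 1) - 1], every term becomes a multiple of [qbinom q a b]. What remains
    is q^(a+1) - 1 = (q^(a-b) - 1) + q^(a-b) (q^(b+1) - 1). *)
Lemma qbinom_pascal (a b : nat) : (b <= a)%N ->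
  qbinom q a.+1 b.+1 = qbinom q a b.+1 + q%:R ^+ (a - b) * qbinom q a b.
Proof.
move=> ba; apply: (mulfI (expq_sub1_neq0 b)).
have Ea : (q%:R : rat) ^+ a.+1 = q%:R ^+ (a - b) * q%:R ^+ b.+1.
  by rewrite -exprD; congr (_ ^+ _); lia.
rewrite mulrDr qbinomSS qbinomnS Ea; ring.
Qed.

(** Induction lowers [a], [d] and [l] together. By [qbinomSS] both sides gain the same factor
    (q^(d+1) - 1)(q^(a+1) - 1) over the previous case, once denominators are cleared. *)
Lemma qbinom_trinomial (a d l : nat) : (l <= d <= a)%N ->
  qbinom q (a - l)%N (d - l)%N * qbinom q a l = qbinom q a d * qbinom q d l.
Proof.
elim: l a d => [|l IHl] a d; first by rewrite !subn0 !qbinom0 !mulr1.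
case: d a => [|d] [|a] //; first by rewrite andbF.
rewrite !ltnS => /IHl{IHl} IHl; rewrite !subSS.
apply: (mulfI (expq_sub1_neq0 l)); apply: (mulfI (expq_sub1_neq0 d)).
transitivity ((q%:R ^+ d.+1 - 1) * (qbinom q (a - l)%N (d - l)%N *
    ((q%:R ^+ l.+1 - 1) * qbinom q a.+1 l.+1))); first by ring.
transitivity ((q%:R ^+ d.+1 - 1) * qbinom q a.+1 d.+1 *
    ((q%:R ^+ l.+1 - 1) * qbinom q d.+1 l.+1)); last by ring.
rewrite !qbinomSS.
transitivity ((q%:R ^+ d.+1 - 1) * (q%:R ^+ a.+1 - 1) *
    (qbinom q (a - l)%N (d - l)%N * qbinom q a l)); first by ring.
by rewrite IHl; ring.
Qed.

(* By Pascal's rule the terms for [d.+1] are differences of consecutive values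
   of [(-1)^(d - l) * q^'C(d - l + 1, 2) * qbinom q d l]. *)
Lemma alternating_qbinom_sum (d : nat) :
  \sum_(0 <= l < d.+1)
    (-1) ^+ (d - l) * q%:R ^+ 'C(d - l, 2) * qbinom q d l = (d == 0)%:R.
Proof.
case: d => [|d]; first by rewrite big_nat1 subnn qbinom0 !mulr1.
pose h l := (-1) ^+ (d - l) * q%:R ^+ 'C((d - l).+1, 2) * qbinom q d l.
rewrite big_nat_recl //.
rewrite (@telescope_sumr_eq _ _ _ (fun l => - h l)) //=; last first.
  move=> l; rewrite ltnS /h subSS => ld.
  rewrite qbinom_pascal //; move: ld; rewrite leq_eqVlt => /orP[/eqP->|ld].
    by rewrite subnn (qbinom_small _ _ (ltnSn d)) bin_small //; ring.
  have -> : (d - l = (d - l.+1).+1)%N by lia.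
  rewrite (binS _.+1) bin1 exprD !exprS; ring.
(* The sum telescopes to [h 0 - h d.+1]. Here [h d.+1] vanishes and [h 0] cancels the term [l = 0]
   split off before. *)
by rewrite /h !subn0 (qbinom_small _ _ (ltnSn d)) exprS !qbinom0 mulr0; ring.
Qed.

Lemma qbinom_inversion (n : nat) (A B : nat -> rat) :
  (forall u, (u <= n)%N ->
     B u = \sum_(0 <= w < u.+1) qbinom q (n - w)%N (u - w)%N * A w) ->
  forall w, (w <= n)%N ->
  A w = \sum_(0 <= u < w.+1)
    qbinom q (n - u)%N (w - u)%N * (-1) ^+ (w - u) * q%:R ^+ 'C(w - u, 2) * B u.
Proof.
move=> BE w wn; pose c u := (-1) ^+ (w - u) * (q%:R : rat) ^+ 'C(w - u, 2).
(* Substituting [BE] and exchanging the sums makes the inner sum the coefficient of [A v]; [inner]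
   evaluates it to the Kronecker delta of [w] and [v]. *)
transitivity (\sum_(0 <= v < w.+1) (\sum_(0 <= u < w.+1 | (v <= u)%N)
    qbinom q (n - u)%N (w - u)%N * qbinom q (n - v)%N (u - v)%N * c u) * A v).
  have inner v : (v <= w)%N -> \sum_(0 <= u < w.+1 | (v <= u)%N)
      qbinom q (n - u)%N (w - u)%N * qbinom q (n - v)%N (u - v)%N * c u
      = (w == v)%:R.
    move=> vw; rewrite -(big_nat_widenl _ 0 _ predT) //.
    (* The shift [u = l + v] turns the sum into the alternating one for [d = w - v]. *)
    rewrite -{1}[v]add0n big_addn subSn //.
    transitivity (qbinom q (n - v)%N (w - v)%N * ((w - v)%N == 0%N)%:R); last first.
      have [->|neq_wv] := eqVneq w v; first by rewrite subnn qbinom0 mulr1.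
      by rewrite subn_eq0 leqNgt ltn_neqAle eq_sym neq_wv vw mulr0.
    rewrite -alternating_qbinom_sum big_distrr /=; apply: eq_big_nat => l /andP[_].
    rewrite ltnS => lwv.
    have -> : (n - (l + v) = (n - v) - l)%N by lia.
    have E : (w - (l + v) = (w - v) - l)%N by lia.
    by rewrite /c E addnK qbinom_trinomial ?lwv ?leq_sub2r //; ring.
  rewrite big_nat_recr //= inner // eqxx mul1r big_nat_cond big1 ?add0r // => v.
  case/andP=> /andP[_ vw] _.
  by rewrite inner 1?ltnW // (gtn_eqF vw) mul0r.
under eq_bigr do rewrite big_distrl /=.
rewrite (exchange_big_dep_nat xpredT) //=; apply: eq_big_nat => u /andP[_].
rewrite ltnS => uw; rewrite BE ?(leq_trans uw) //.
rewrite big_distrr [RHS](big_nat_widen _ _ w.+1) //=.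
by apply: eq_big => [v|v _]; rewrite ?ltnS // /c; ring.
Qed.

End QBinomial.

(** * Counting subspaces over a finite field *)

Section Counting.
Variables (F : finFieldType) (vT : vectType F).
Implicit Types U V W : {vspace vT}.
Local Notation q := #|F|.

Lemma card_setD_vspace U W : (W <= U)%VS ->
  #|[set x : finvect_type vT | (x \in U) && (x \notin W)]|%:R
    = (q%:R : rat) ^+ \dim U - q%:R ^+ \dim W.
Proof.
move=> /subvP sWU.
have cardE (V : {vspace vT}) :
    #|[set x : finvect_type vT | x \in V]| = (q ^ \dim V)%N.
  (* [card_vspace] takes a vector structure on a finite carrier, so [vT] is opened into carrier and
     structure. *)
  rewrite cardsE; case: vT V => T cT V.
  exact: (@card_vspace F (finvect_type (Vector.Pack cT)) cT V).
have -> : [set x : finvect_type vT | (x \in U) && (x \notin W)]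
    = [set x : finvect_type vT | x \in U] :\: [set x : finvect_type vT | x \in W].
  by apply/setP => x; rewrite !inE andbC.
rewrite cardsD (setIidPr _); last by apply/subsetP => x; rewrite !inE; apply: sWU.
rewrite !cardE natrB ?natrX //.
by rewrite leq_exp2l ?card_finNzRing_gt1 // dimvS //; apply/subvP.
Qed.

(* Counts pairs (U, x) with x in U but not in W: for given x the U are the
   intermediate spaces for W + <x>. *)
Lemma card_interval W V b : (W <= V)%VS ->
  #|[set U | [&& (W <= U)%VS, (U <= V)%VS & \dim U == (\dim W + b)%N]]|%:R
    = qbinom q (\dim V - \dim W)%N b.
Proof.
have q_gt1 : (1 < q)%N by apply: card_finNzRing_gt1.
elim: b W => [|b IHb] W sWV.
  rewrite qbinom0 addn0 (_ : [set U | _] = [set W]) ?cards1 //.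
  apply/setP => U; rewrite !inE; apply/and3P/eqP => [[sWU _ dU]|->].
    by apply/eqP; rewrite eq_sym eqEdim sWU (eqP dU) /=.
  by rewrite subvv.
set S := [set U | _].
have dW_neq0 : (q%:R : rat) ^+ \dim W != 0.
  by rewrite expf_neq0 // pnatr_eq0 -lt0n ltnW.
have card2 : \sum_(U in S) \sum_(x : finvect_type vT | (x \in U) && (x \notin W)) 1
    = (q%:R ^+ \dim V - q%:R ^+ \dim W) * qbinom q (\dim V - (\dim W).+1)%N b.
  rewrite (exchange_big_dep
    (fun x : finvect_type vT => (x \in V) && (x \notin W))) /=; last first.
    move=> U x; rewrite inE => /and3P[_ /subvP sUV _] /andP[xU ->].
    by rewrite sUV.
  rewrite -card_setD_vspace // -sumr_const big_distrl /=.
  rewrite [RHS](eq_bigl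
    (fun x : finvect_type vT => (x \in V) && (x \notin W))); last first.
    by move=> x; rewrite inE.
  apply: eq_bigr => x /andP[xV xW].
  have x_neq0 : (x : vT) != 0 by apply: contraNneq xW => ->; apply: mem0v.
  have dWx : \dim (W + <[x : vT]>) = (\dim W).+1.
    rewrite dimv_disjoint_sum; last first.
      apply/eqP; rewrite -subv0; apply/subvP => y.
      rewrite memv_cap memv0 => /andP[yW /vlineP[a ya]]; move: yW; rewrite ya.
      have [-> _|a0] := eqVneq a 0; first by rewrite scale0r.
      by rewrite rpredZeq (negbTE a0) /= => xW'; case/negP: xW.
    by rewrite dim_vline x_neq0 addn1.
  rewrite mul1r -dWx -IHb; last by rewrite subv_add sWV -memvE.
  rewrite -sumr_const; apply: eq_bigl => U.
  rewrite !inE xW andbT subv_add -memvE dWx addnS addSn.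
  by rewrite -!andbA; do !bool_congr.
(* The same pairs counted by [U]: each [U] in [S] has dimension [\dim W + b.+1], hence the same
   number of vectors outside [W]. *)
have {card2} : #|S|%:R * (q%:R ^+ (\dim W + b.+1) - q%:R ^+ \dim W)
    = (q%:R ^+ \dim V - q%:R ^+ \dim W) * qbinom q (\dim V - (\dim W).+1)%N b.
  rewrite -card2 -sumr_const big_distrl /=; apply: eq_bigr => U.
  rewrite inE => /and3P[sWU _ /eqP dU].
  rewrite mul1r -dU -card_setD_vspace // -sumr_const.
  by apply: eq_bigl => x; rewrite inE.
have [a dV] : exists a, \dim V = (\dim W + a)%N.
  by exists (\dim V - \dim W)%N; rewrite subnKC ?dimvS.
have factor t : q%:R ^+ \dim W * t - q%:R ^+ \dim W = q%:R ^+ \dim W * (t - 1).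
  by rewrite mulrBr mulr1.
rewrite dV addKn subnS addKn !exprD !factor mulrCA -mulrA => /(mulfI dW_neq0) E.
apply: (mulfI (expq_sub1_neq0 _ q_gt1 b)); rewrite mulrC E.
(* For positive [a] this is absorption. For [a = 0] the left side has the factor [q ^ 0 - 1] and the
   right side is a q-binomial of 0 over [b.+1], so both vanish. *)
case: a {dV E} => [|a]; last by rewrite qbinomSS.
by rewrite subrr mul0r qbinom_small ?mulr0.
Qed.

Lemma card_subspaces V i :
  #|[set D | (D <= V)%VS && (\dim D == i)]|%:R = qbinom q (\dim V) i.
Proof.
have -> : \dim V = (\dim V - \dim (0%VS : {vspace vT}))%N by rewrite dimv0 subn0.
rewrite -card_interval ?sub0v //.
by congr (#|pred_of_set _|%:R); apply/setP => D; rewrite !inE sub0v dimv0.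
Qed.

Lemma card_supspaces W u : (\dim W <= u)%N ->
  #|[set U | (W <= U)%VS && (\dim U == u)]|%:R
    = qbinom q (\dim {:vT} - \dim W)%N (u - \dim W)%N.
Proof.
move=> dWu; rewrite -card_interval ?subvf // subnKC //.
by congr (#|pred_of_set _|%:R); apply/setP => D; rewrite !inE subvf.
Qed.

End Counting.

(** * Moments and weights for an abstract support map *)

Section SupportMoments.
Variables (F : finFieldType) (vT sT : vectType F) (C : {vspace vT}).
Variables (supp : {vspace vT} -> {vspace sT}) (part : {vspace sT} -> {vspace vT}).
Hypothesis sub_part : forall D U, (D <= part U)%VS = (D <= C)%VS && (supp D <= U)%VS.
Local Notation q := #|F|.

(** The adjunction [sub_part] turns subspaces of [part U] into subspaces of [C] with support in [U].
    Keeping [supp] and [part] abstract lets one double count serve columns and rows. *)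
Lemma support_moment (i u : nat) :
  \sum_(U : {vspace sT} | \dim U == u) qbinom q (\dim (part U)) i
  = \sum_(0 <= w < u.+1) qbinom q (\dim {:sT} - w)%N (u - w)%N *
      \sum_(W : {vspace sT} | \dim W == w)
        #|[set D : {vspace vT} | [&& (D <= C)%VS, \dim D == i & supp D == W]]|%:R.
Proof.
pose S := [set D : {vspace vT} | (D <= C)%VS && (\dim D == i)].
transitivity (\sum_(D in S)
    \sum_(U : {vspace sT} | (supp D <= U)%VS && (\dim U == u)) (1 : rat)).
  under eq_bigr => U _ do rewrite -card_subspaces -sumr_const.
  rewrite (exchange_big_dep (mem S)) /=; last first.
    by move=> U D _; rewrite !inE sub_part => /andP[/andP[-> _] ->].
  apply: eq_bigr => D; rewrite inE => /andP[DC dD]; apply: eq_bigl => U.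
  by rewrite !inE sub_part DC dD andbT andbC.
(* The sum over [w] has at most one term. It is empty when [\dim (supp D)] exceeds [u], in which
   case no [U] of dimension [u] contains [supp D]. *)
transitivity (\sum_(D in S) \sum_(0 <= w < u.+1 | w == \dim (supp D))
    qbinom q (\dim {:sT} - w)%N (u - w)%N).
  apply: eq_bigr => D _; rewrite big_nat1_eq ltnS leq0n /=.
  case: leqP => [du|ud].
    by rewrite -card_supspaces // -sumr_const; apply: eq_bigl => U; rewrite inE.
  rewrite big_pred0 // => U; apply/negP => /andP[/dimvS sU /eqP dU].
  by move: ud; rewrite ltnNge -dU sU.
rewrite (exchange_big_dep xpredT) //=; apply: eq_bigr => w _.
rewrite (partition_big supp (fun W => \dim W == w)) /=; last first.
  by move=> D /andP[_ /eqP ->].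
rewrite big_distrr /=; apply: eq_bigr => W /eqP dW.
rewrite -sumr_const big_distrr /=; apply: eq_big => [D|D _]; last by rewrite mulr1.
rewrite !inE -!andbA; do !congr (_ && _).
by apply/andP/idP => [[] // | /eqP ->]; rewrite dW.
Qed.

End SupportMoments.

(** * Column and row supports of matrix codes *)

Section MatrixCodes.
Variables (F : finFieldType) (n m : nat) (C : {vspace 'M[F]_(n, m)}).
Implicit Types D : {vspace 'M[F]_(n, m)}.

(** A sum of subspaces lies in [U] exactly when each summand does; this provides [sub_part] for
    columns. *)
Lemma sub_colcode D U : (D <= colcode C U)%VS = (D <= C)%VS && (colsupp D <= U)%VS.
Proof.
apply/subvP/andP => [sDU|[/subvP sDC /subv_sumP sDU] M MD].
  split; first by apply/subvP => M /sDU; rewrite memv_colcode => /andP[].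
  by apply/subv_sumP => M /sDU; rewrite memv_colcode => /andP[].
by rewrite memv_colcode sDC ?sDU.
Qed.

Lemma sub_rowcode D U : (D <= rowcode C U)%VS = (D <= C)%VS && (rowsupp D <= U)%VS.
Proof.
apply/subvP/andP => [sDU|[/subvP sDC /subv_sumP sDU] M MD].
  split; first by apply/subvP => M /sDU; rewrite memv_rowcode => /andP[].
  by apply/subv_sumP => M /sDU; rewrite memv_rowcode => /andP[].
by rewrite memv_rowcode sDC ?sDU.
Qed.

Lemma gen_moment_weights (i u : nat) : (n <= m)%N ->
  gen_moment i C u =
    \sum_(0 <= w < u.+1) qbinom #|F| (n - w)%N (u - w)%N * gen_weight i C w.
Proof.
move=> nm; rewrite /gen_moment /gen_weight.
have dimc : \dim {: 'cV[F]_n} = n by rewrite dimvf /dim /= muln1.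
rewrite (support_moment _ _ _ _ _ _ sub_colcode) dimc.
(* What is left is [n = m], where row supports live in a space of dimension [n] too, so both halves
   carry the same coefficients. *)
case: ltnP => // mn.
have dimr : \dim {: 'rV[F]_m} = n.
  by rewrite dimvf /dim /= mul1n; apply/anti_leq; rewrite mn nm.
rewrite (support_moment _ _ _ _ _ _ sub_rowcode) dimr.
rewrite -big_split big_distrr; apply: eq_bigr => w _ /=.
by rewrite -mulrDr mulrCA.
Qed.

End MatrixCodes.

Theorem theorem3p8 (F : finFieldType) (q n m : nat)
    (hq : #|F| = q) (hn : (2 <= n)%N) (hnm : (n <= m)%N)
    (C : {vspace 'M[F]_(n, m)}) (k : nat) (hk : \dim C = k)
    (i : nat) (hi : (i <= k)%N) :
  (forall u : nat, (u <= n)%N ->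
     gen_moment i C u =
       \sum_(0 <= w < u.+1)
         qbinom q (n%:Z - w%:Z) (u%:Z - w%:Z) * gen_weight i C w) /\
  (forall w : nat, (w <= n)%N ->
     gen_weight i C w =
       \sum_(0 <= u < w.+1)
         qbinom q (n%:Z - u%:Z) (w%:Z - u%:Z) *
         (-1) ^+ (w - u) * q%:R ^+ 'C(w - u, 2) * gen_moment i C u).
Proof.
(* Over the summation ranges all integer differences are nonnegative, so the natural-argument
   identities apply. *)
have subE (a b : nat) : (b <= a)%N -> a%:Z - b%:Z = (a - b)%N%:Z by move=> ba; lia.
have q_gt1 : (1 < q)%N by rewrite -hq card_finNzRing_gt1.
have momentE u : gen_moment i C u =
    \sum_(0 <= w < u.+1) qbinom q (n - w)%N (u - w)%N * gen_weight i C w.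
  by rewrite -hq gen_moment_weights.
split=> [u un|w wn].
  rewrite momentE; apply: eq_big_nat => w /andP[_]; rewrite ltnS => wu.
  by rewrite !subE // (leq_trans wu).
rewrite (qbinom_inversion _ q_gt1 n _ _ (fun u _ => momentE u)) //.
apply: eq_big_nat => u /andP[_]; rewrite ltnS => uw.
by rewrite !subE // (leq_trans uw).
Qed.
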